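(* Let $U$ be a finite set, $\mathcal{O}\subseteq\mathcal{P}(U)$ an independent set of obligations, and $X\subseteq U$. Then: (1) If $X\prec_{l,s}U\setminus X$, then $X$ is $\preceq_s$-closed. (2) If $X$ is (ui), then $X$ is $\preceq_s$-closed. (3) If $X\in\mathcal{D}(\mathcal{O})$, then $X$ is $\preceq_s$-closed. (4) If $X$ is a neighbourhood, or an improving neighbourhood, of the set of best elements in $U$, then $X$ is $\preceq_s$-closed.
   Context: $U$ is a finite set, and $\mathcal{O}\subseteq\mathcal{P}(U)$ is a set of ''obligations''. For $\mathcal{O}'\subseteq\mathcal{O}$, $\delta:\mathcal{O}'\to\{0,1\}$ and $m\in U$, $m\models\delta$ iff for all $O\in\mathcal{O}'$: $m\in O\Leftrightarrow\delta(O)=1$. $\mathcal{O}$ is independent iff for every $\delta:\mathcal{O}\to\{0,1\}$ there is $m\in U$ with $m\models\delta$. For $x,y\in U$: - $\mathcal{O}(x):=\{O\in\mathcal{O}: x\in O\}$. - Quality (set variant; smaller means better): $x\preceq_s y$ iff $\mathcal{O}(y)\subseteq\mathcal{O}(x)$; $x\prec_s y$ iff $\mathcal{O}(y)\subsetneq\mathcal{O}(x)$. - Distance (set variant): $d_s(x,y):=\mathcal{O}(x)\,\triangle\,\mathcal{O}(y)$ (symmetric difference); distances are compared by inclusion. - $[x,z]_s:=\{y\in U: d_s(x,z)=d_s(x,y)\cup d_s(y,z)\}$. - A best element of $U$ is some $x\in U$ such that there is no $z\in U$ with $z\prec_s x$. - $X\subseteq U$ is $\preceq_s$-closed iff for all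 $x\in X$, $y\in U$: $y\preceq_s x$ implies $y\in X$. - An element $x'$ of a set $Y$ is closest to $x$ in $Y$ iff there is no $x''\in Y$ with $d_s(x,x'')\subsetneq d_s(x,x')$. Let $x\parallel Y$ be the set of elements of $Y$ closest to $x$. - $X\prec_{l,s}Y$ iff for all $x\in X$ and all $y\in x\parallel Y$ we have $x\prec_s y$, and for all $y\in Y$ and all $x\in y\parallel X$ we have $x\prec_s y$. - $X$ is (ui) (union of intersections) iff there is a family $(\mathcal{O}_i)_{i\in I}$ with $\mathcal{O}_i\subseteq\mathcal{O}$ and $X=\bigcup_{i\in I}\bigcap\mathcal{O}_i$, where $\bigcap\emptyset:=U$. - $X\in\mathcal{D}(\mathcal{O})$ iff for all $\mathcal{O}'\subseteq\mathcal{O}$, all $\delta:\mathcal{O}'\to\{0,1\}$ and all $m,m'\in U$ with $m,m'\models\delta$, $m\in X$, $m'\notin X$, there is $m''\in X$ with $m''\models\delta$ and $m''\prec_s m'$. - For $B\subseteq Y\subseteq U$: $Y$ is a neighbourhood of $B$ in $U$ iff for all $y\in Y$ and all $x\in B$ closest to $y$ in $B$, $[x,y]_s\subseteq Y$. $Y$ is an improving neighbourhood of $B$ in $U$ iff for all $y\in Y$ and all $x$ that are closest to $y$ in $\{x'\in B: x'\preceq_s y\}$, $[x,y]_s\subseteq Y$. (Both notions require $B\subseteq Y$.) *)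

(* Defs.v *)
From mathcomp Require Import all_boot.

Set Implicit Arguments.
Unset Strict Implicit.
Unset Printing Implicit Defensive.

(* The finite set U is the full carrier of a finType; [Os] is the set of
   obligations. *)

(* An assignment delta : Os' -> {0,1} is encoded by a total function
   {set U} -> bool, of which only the values on Os' are ever inspected. *)
Definition models (U : finType) (Os' : {set {set U}}) (delta : {set U} -> bool)
    (m : U) : Prop :=
  forall O : {set U}, O \in Os' -> (m \in O <-> delta O = true).

Definition independent (U : finType) (Os : {set {set U}}) : Prop :=
  forall delta : {set U} -> bool, exists m : U, models Os delta m.

Definition obl (U : finType) (Os : {set {set U}}) (x : U) : {set {set U}} :=
  [set O in Os | x \in O].

(* Smaller means better: x is below y when x satisfies more obligations. *)
Definition preceq_s (U : finType) (Os : {set {set U}}) (x y : U) : bool :=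
  obl Os y \subset obl Os x.

Definition prec_s (U : finType) (Os : {set {set U}}) (x y : U) : bool :=
  obl Os y \proper obl Os x.

Definition dist_s (U : finType) (Os : {set {set U}}) (x y : U) :
    {set {set U}} :=
  (obl Os x :\: obl Os y) :|: (obl Os y :\: obl Os x).

Definition interval_s (U : finType) (Os : {set {set U}}) (x z : U) : {set U} :=
  [set y | dist_s Os x z == dist_s Os x y :|: dist_s Os y z].

Definition best (U : finType) (Os : {set {set U}}) : {set U} :=
  [set x | ~~ [exists z, prec_s Os z x]].

Definition preceq_s_closed (U : finType) (Os : {set {set U}}) (X : {set U}) :
    Prop :=
  forall x y : U, x \in X -> preceq_s Os y x -> y \in X.

(* The set x || Y of elements of Y closest to x. *)
Definition closest (U : finType) (Os : {set {set U}}) (x : U) (Y : {set U}) :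
    {set U} :=
  [set x' in Y |
    ~~ [exists x'' in Y, dist_s Os x x'' \proper dist_s Os x x']].

Definition prec_ls (U : finType) (Os : {set {set U}}) (X Y : {set U}) : Prop :=
  (forall x y : U, x \in X -> y \in closest Os x Y -> prec_s Os x y) /\
  (forall x y : U, y \in Y -> x \in closest Os y X -> prec_s Os x y).

(* The index type I is arbitrary; a \bigcap over the empty set is [set: U]. *)
Definition ui (U : finType) (Os : {set {set U}}) (X : {set U}) : Prop :=
  exists (I : Type) (Oi : I -> {set {set U}}),
    (forall i : I, Oi i \subset Os) /\
    (forall x : U, x \in X <-> exists i : I, x \in \bigcap_(O in Oi i) O).

(* X \in D(Os). *)
Definition in_D (U : finType) (Os : {set {set U}}) (X : {set U}) : Prop :=
  forall (Os' : {set {set U}}) (delta : {set U} -> bool) (m m' : U),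
    Os' \subset Os ->
    models Os' delta m -> models Os' delta m' ->
    m \in X -> m' \notin X ->
    exists m'' : U, [/\ m'' \in X, models Os' delta m'' & prec_s Os m'' m'].

Definition neighbourhood (U : finType) (Os : {set {set U}}) (B Y : {set U}) :
    Prop :=
  B \subset Y /\
  forall y x : U, y \in Y -> x \in closest Os y B ->
    interval_s Os x y \subset Y.

Definition improving_neighbourhood (U : finType) (Os : {set {set U}})
    (B Y : {set U}) : Prop :=
  B \subset Y /\
  forall y x : U, y \in Y ->
    x \in closest Os y [set x' in B | preceq_s Os x' y] ->
    interval_s Os x y \subset Y.

(* Main.v *)
Require Import Defs.
From mathcomp Require Import all_boot.

(** All four parts compare [x \in X] with a [y] satisfying every obligation
    that [x] satisfies, so that [dist_s x y] consists of obligations satisfied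
    by [y] only.  If [y \notin X], an element of [~: X] closest to [x] and no
    further than [y] cannot be worse than [x], which gives (1); the [delta]
    on which [x] and [y] agree has no model better than [y], which gives (3).
    For (4), independence yields an ideal element [b], satisfying all
    obligations; the best elements are then exactly the ideal ones, hence all
    equidistant from [x], and [y] lies between [b] and [x]. *)

Section Obligations.

Set Implicit Arguments.
Unset Strict Implicit.

Variables (U : finType) (Os : {set {set U}}).
Implicit Types (x y b : U) (X Y : {set U}).

Lemma in_obl x (O : {set U}) : (O \in obl Os x) = (O \in Os) && (x \in O).
Proof. by rewrite inE. Qed.

Lemma obl_sub x : obl Os x \subset Os.
Proof. by apply/subsetP => O; rewrite in_obl => /andP[]. Qed.

(** Among the elements of [Y] no further from [x] than [y], one at a distance of least cardinality
    is closest: a strictly smaller distance would have fewer elements. *)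
Lemma exists_closest x y Y : y \in Y ->
  exists2 y', y' \in closest Os x Y & dist_s Os x y' \subset dist_s Os x y.
Proof.
move=> yY.
pose P y' := (y' \in Y) && (dist_s Os x y' \subset dist_s Os x y).
have Py : P y by rewrite /P yY subxx.
case: (arg_minnP (fun y' => #|dist_s Os x y'|) Py) => y' /andP[y'Y sy'] ymin.
exists y' => //; rewrite inE y'Y /=; apply/existsP => -[z /andP[zY ltz]].
have Pz : P z by rewrite /P zY (subset_trans (proper_sub ltz)).
by have := proper_card ltz; rewrite ltnNge ymin.
Qed.

Lemma prec_ls_closed X : prec_ls Os X (~: X) -> preceq_s_closed Os X.
Proof.
move=> [betterX _] x y xX le_yx; apply: contraT => yNX.
have yCX : y \in ~: X by rewrite inE.
have [y' y'closest /subsetP sub_dist] := exists_closest x yCX.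
(* [O] separates [x] from [y'], hence also [x] from [y], although [y] satisfies all that [x]
   does. *)
have /properP[_ [O Ox ONy']] := betterX x y' xX y'closest.
have /sub_dist : O \in dist_s Os x y' by rewrite inE in_setD Ox ONy'.
by rewrite inE !in_setD Ox (subsetP le_yx _ Ox).
Qed.

(** Whichever [Oi i] witnesses [x \in X] also witnesses [y \in X]. *)
Lemma ui_closed X : ui Os X -> preceq_s_closed Os X.
Proof.
move=> [I [Oi [subOs XE]]] x y /XE[i /bigcapP xi] le_yx.
apply/XE; exists i; apply/bigcapP => O Oin.
have Ox : O \in obl Os x by rewrite in_obl (subsetP (subOs i) _ Oin) xi.
by have := subsetP le_yx _ Ox; rewrite in_obl => /andP[].
Qed.

Lemma in_D_closed X : in_D Os X -> preceq_s_closed Os X.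
Proof.
move=> XD x y xX le_yx; apply: contraT => yNX.
pose Os' := [set O in Os | (x \in O) == (y \in O)].
have sub' : Os' \subset Os by apply/subsetP => O; rewrite inE => /andP[].
have mx : models Os' (fun O => x \in O) x by [].
have my : models Os' (fun O => x \in O) y.
  by move=> O; rewrite inE => /andP[_ /eqP ->].
have [z [_ mz /properP[_ [O]]]] := XD Os' _ x y sub' mx my xX yNX.
rewrite !in_obl => /andP[OOs zO]; rewrite OOs /= => yNO.
(* [x] and [y] both violate [O], so [O] lies in [Os'] and its model [z] has to violate it too. *)
have xNO : x \notin O.
  apply: contra yNO => xO.
  have Ox : O \in obl Os x by rewrite in_obl OOs.
  by have := subsetP le_yx _ Ox; rewrite in_obl => /andP[].
have OOs' : O \in Os' by rewrite inE OOs (negbTE xNO) (negbTE yNO).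
by have /(mz O OOs') := zO; rewrite (negbTE xNO).
Qed.

Lemma exists_ideal : independent Os -> exists b, obl Os b = Os.
Proof.
move=> /(_ (fun=> true))[b mb]; exists b; apply/setP => O.
by rewrite in_obl; case: (boolP (O \in Os)) => //= /mb[_ ->].
Qed.

Lemma ideal_best b : obl Os b = Os -> b \in best Os.
Proof.
move=> bE; rewrite inE; apply/existsP => -[z].
by rewrite /prec_s bE properE obl_sub andbF.
Qed.

Lemma best_ideal b x : obl Os b = Os -> x \in best Os -> obl Os x = Os.
Proof.
move=> bE; rewrite inE => /existsPn /(_ b); rewrite /prec_s bE.
by rewrite properE obl_sub /= negbK => ?; apply/eqP; rewrite eqEsubset obl_sub.
Qed.

(** A general [Y] covers both kinds of neighbourhood: all best elements, or only those at least as
    good as [x]. *)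
Lemma closest_ideal b x Y : obl Os b = Os -> Y \subset best Os -> b \in Y ->
  b \in closest Os x Y.
Proof.
move=> bE /subsetP subY bY; rewrite inE bY /=; apply/existsP => -[z /andP[zY]].
by rewrite /dist_s bE (best_ideal bE (subY z zY)) properxx.
Qed.

(** The obligations that [x] violates are those that [y] violates together with those gained from
    [x] to [y]. *)
Lemma interval_ideal b x y : obl Os b = Os -> preceq_s Os y x ->
  y \in interval_s Os b x.
Proof.
move=> bE /subsetP le_yx; rewrite inE /dist_s bE; apply/eqP/setP => O.
rewrite !(in_setU, in_setD); have := le_yx O.
rewrite !in_obl; case: (O \in Os) => //=.
by case: (x \in O) => [-> //|_]; case: (y \in O).
Qed.

Lemma neighbourhood_best_closed X : independent Os ->
  neighbourhood Os (best Os) X -> preceq_s_closed Os X.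
Proof.
move=> /exists_ideal[b bE] [_ nbhX] x y xX le_yx.
have bclosest := closest_ideal x bE (subxx _) (ideal_best bE).
exact: subsetP (nbhX x b xX bclosest) y (interval_ideal bE le_yx).
Qed.

Lemma improving_neighbourhood_best_closed X : independent Os ->
  improving_neighbourhood Os (best Os) X -> preceq_s_closed Os X.
Proof.
move=> /exists_ideal[b bE] [_ nbhX] x y xX le_yx.
have bclosest : b \in closest Os x [set x' in best Os | preceq_s Os x' x].
  apply: (closest_ideal _ bE).
    by apply/subsetP => z; rewrite inE => /andP[].
  by rewrite inE ideal_best //= /preceq_s bE obl_sub.
exact: subsetP (nbhX x b xX bclosest) y (interval_ideal bE le_yx).
Qed.

End Obligations.

Theorem fact4p4 (U : finType) (Os : {set {set U}}) (X : {set U})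
    (Hind : independent Os) :
  (prec_ls Os X (~: X) -> preceq_s_closed Os X) /\
  (ui Os X -> preceq_s_closed Os X) /\
  (in_D Os X -> preceq_s_closed Os X) /\
  (neighbourhood Os (best Os) X \/ improving_neighbourhood Os (best Os) X ->
   preceq_s_closed Os X).
Proof.
split; first exact: prec_ls_closed.
split; first exact: ui_closed.
split; first exact: in_D_closed.
by case; [exact: neighbourhood_best_closed
         | exact: improving_neighbourhood_best_closed].
Qed.
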